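(* Let $(\mathsf{X},\mathcal{X})$ and $(\mathsf{Y},\mathcal{Y})$ be measurable spaces and let $\mathsf{Z}\subseteq\mathsf{X}\times\mathsf{Y}$ be a complete separable metric space with a bounded metric $\rho$, endowed with its Borel $\sigma$-algebra $\mathfrak{B}(\mathsf{Z})$. Let $\mathrm{pr}_\mathsf{X}:\mathsf{Z}\to\mathsf{X}$, $\mathrm{pr}_\mathsf{Y}:\mathsf{Z}\to\mathsf{Y}$ be the projections, and assume $\mathrm{pr}_\mathsf{X}^{-1}(\mathrm{pr}_\mathsf{X}(\mathsf{Z})\cap\mathcal{X})\subseteq\mathfrak{B}(\mathsf{Z})$ and $\mathrm{pr}_\mathsf{Y}^{-1}(\mathrm{pr}_\mathsf{Y}(\mathsf{Z})\cap\mathcal{Y})\subseteq\mathfrak{B}(\mathsf{Z})$. Let $\{Z_n\}_{n\ge0}$ be a temporally homogeneous Markov chain on $\mathsf{Z}$ with one-step transition kernel $\mathcal{P}(z,\mathrm{d}\bar z)$. Assume: (A1) $\mathsf{Y}\subseteq\mathbb{R}$, $\mathcal{Y}=\mathfrak{B}(\mathbb{R})\cap\mathsf{Y}$, and $\mathscr{H}\subseteq\mathsf{Y}^{\mathsf{X}}$ is a totally bounded metric space with metric $\rho_\mathscr{H}$; (A2) $\ell:\mathsf{Y}\times\mathsf{Y}\to[0,\infty)$ is measurable and, writing $\ell_h(z):=\ell(h(\mathrm{pr}_\mathsf{X}(z)),\mathrm{pr}_\mathsf{Y}(z))$ for $h\in\mathscr{H}$, there are $L,\bar L\ge0$ with $|\ell_{h_1}(z_1)-\ell_{h_2}(z_2)|\le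 L\rho(z_1,z_2)+\bar L\rho_\mathscr{H}(h_1,h_2)$ for all $z_1,z_2\in\mathsf{Z}$, $h_1,h_2\in\mathscr{H}$; (A3) $\mathsf{Y}$ is bounded and there is $\eta\in(0,1)$ such that $\mathscr{W}(\mathcal{P}(z_1,\cdot),\mathcal{P}(z_2,\cdot))\le(1-\eta)\rho(z_1,z_2)$ for all $z_1,z_2\in\mathsf{Z}$. Let $\pi$ be the (unique) invariant probability measure of $\{Z_n\}_{n\ge0}$ and let $C_1,C_2>0$ be constants such that $\mathscr{W}(\mathcal{P}^n(z,\cdot),\pi)\le C_1\mathrm{e}^{-C_2n}$ for all $z\in\mathsf{Z}$ and $n\ge0$ (such $\pi$, $C_1$, $C_2$ exist under (A3)). Fix $\varepsilon>0$, $\delta\in(0,1)$ and an $\varepsilon$-ASEM algorithm $\mathcal{A}^\varepsilon$ for $\mathscr{H}$. Then for any initial distribution $\mu$ of $\{Z_n\}_{n\ge0}$, $$\mathbb{P}_\mu\Big(\big|\mathrm{er}_\pi\big(\mathcal{A}^\varepsilon(Z_0,\dots,Z_{n-1})\big)-\mathrm{opt}_\pi(\mathscr{H})\big|<5\varepsilon\Big)\ge1-\delta\qquad\text{for all } n\ge n_1(\varepsilon,\delta),$$ where $$n_1(\varepsilon,\delta):=\max\left\{\frac{16C_1L}{\varepsilon(1-\mathrm{e}^{-C_2})},\ \frac{128C_1^2L^2\ln\frac{\mathcal{N}(\varepsilon/4\bar L,\mathscr{H},\rho_\mathscr{H})}{\delta}}{\varepsilon^2(1-\mathrm{e}^{-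C_2})^2}\right\}.$$
   Context: The Markov chain is understood as a family $(\Omega,\mathcal{F},\mathbb{P}_z,\{Z_n\}_{n\ge0})_{z\in\mathsf{Z}}$ with $\mathbb{P}_z(Z_0=z)=1$; for a probability measure $\mu$ on $\mathsf{Z}$, $\mathbb{P}_\mu:=\int\mathbb{P}_z\,\mu(\mathrm{d}z)$. $\mathcal{P}^n$ is the $n$-step kernel. Total boundedness means: for each $\epsilon>0$ there is a finite $\mathscr{H}_\epsilon\subseteq\mathscr{H}$ such that every $h\in\mathscr{H}$ has some $h_\epsilon\in\mathscr{H}_\epsilon$ with $\rho_\mathscr{H}(h,h_\epsilon)<\epsilon$ (an $\epsilon$-covering); $\mathcal{N}(\epsilon,\mathscr{H},\rho_\mathscr{H})$ is the minimal cardinality of such an $\epsilon$-covering. $\mathscr{W}$ is the $L^1$-Wasserstein distance on probability measures on $\mathsf{Z}$: $\mathscr{W}(\mu_1,\mu_2)=\inf_{\Pi}\int\rho(z,\bar z)\,\Pi(\mathrm{d}z,\mathrm{d}\bar z)$, infimum over couplings $\Pi$ of $\mu_1,\mu_2$. Notation: $\mathrm{er}_\pi(h):=\int\ell_h\,\mathrm{d}\pi$, $\mathrm{opt}_\pi(\mathscr{H}):=\inf_{h\in\mathscr{H}}\mathrm{er}_\pi(h)$. For $\varepsilon>0$, an $\varepsilon$-ASEM (approximate sample error minimization) algorithm for $\mathscr{H}$ is a map $\mathcal{A}^\varepsilon:\bigcup_{n\ge1}\mathsf{Z}^n\to\mathscr{H}$ such that for all $n$ and $z_0,\dots,z_{n-1}\in\mathsf{Z}$,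 $\frac1n\sum_{i=0}^{n-1}\ell_{\mathcal{A}^\varepsilon(z_0,\dots,z_{n-1})}(z_i)<\inf_{h\in\mathscr{H}}\frac1n\sum_{i=0}^{n-1}\ell_h(z_i)+\varepsilon$. *)

(* Defs.v *)
From HB Require Import structures.
From mathcomp Require Import all_boot all_order all_algebra.
From mathcomp Require Import all_classical all_reals all_analysis.
Set Implicit Arguments. Unset Strict Implicit. Unset Printing Implicit Defensive.
Import Order.TTheory GRing.Theory Num.Theory.
Import numFieldNormedType.Exports.
Local Open Scope classical_set_scope.
Local Open Scope ring_scope.

Section Defs.
Context {R : realType}.

Definition is_metric {Z : Type} (rho : Z -> Z -> R) : Prop :=
  [/\ forall x y, 0 <= rho x y,
      forall x y, rho x y = 0 <-> x = y,
      forall x y, rho x y = rho y x &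
      forall x y z, rho x z <= rho x y + rho y z].

Definition is_metric_on {T : Type} (H : set T) (rho : T -> T -> R) : Prop :=
  [/\ forall x y, H x -> H y -> 0 <= rho x y,
      forall x y, H x -> H y -> (rho x y = 0 <-> x = y),
      forall x y, H x -> H y -> rho x y = rho y x &
      forall x y z, H x -> H y -> H z -> rho x z <= rho x y + rho y z].

Definition metric_bounded {Z : Type} (rho : Z -> Z -> R) : Prop :=
  exists M : R, forall x y, rho x y <= M.

Definition metric_complete {Z : Type} (rho : Z -> Z -> R) : Prop :=
  forall u : nat -> Z,
    (forall e : R, 0 < e -> exists N : nat, forall m n, (N <= m)%N -> (N <= n)%N ->
        rho (u m) (u n) < e) ->
    exists z : Z, forall e : R, 0 < e -> exists N : nat, forall n, (N <= n)%N ->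
        rho (u n) z < e.

Definition metric_separable {Z : Type} (rho : Z -> Z -> R) : Prop :=
  exists D : set Z, countable D /\
    forall z (e : R), 0 < e -> exists2 d, D d & rho z d < e.

Definition rho_open {Z : Type} (rho : Z -> Z -> R) (A : set Z) : Prop :=
  forall z, A z -> exists2 e : R, 0 < e & forall y, rho z y < e -> A y.

Definition is_borel_of {d} {Z : measurableType d} (rho : Z -> Z -> R) : Prop :=
  (@measurable _ Z) = <<s [set A | rho_open rho A] >>.

Definition trace_measurable {d d'} {T : measurableType d} {U : measurableType d'}
  (D : set T) (f : T -> U) : Prop :=
  forall B : set U, measurable B ->
    exists C : set T, measurable C /\ D `&` f @^-1` B = D `&` C.

Definition is_covering {T : Type} (H : set T) (rhoH : T -> T -> R)
  (r : \bar R) (n : nat) : Prop :=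
  exists f : 'I_n -> T, (forall i, H (f i)) /\
    forall h, H h -> exists i, ((rhoH h (f i))%:E < r)%E.

Definition totally_bounded_on {T : Type} (H : set T) (rhoH : T -> T -> R) : Prop :=
  forall e : R, 0 < e -> exists n, is_covering H rhoH e%:E n.

Definition covering_number {T : Type} (H : set T) (rhoH : T -> T -> R)
  (r : \bar R) : R :=
  inf [set (n%:R : R) | n in [set n | is_covering H rhoH r n]].

Context {d : measure_display} {Z : measurableType d}.

Fixpoint kpow (k : R.-pker Z ~> Z) (n : nat) (z : Z) : set Z -> \bar R :=
  match n with
  | 0%N => fun A => \d_z A
  | n'.+1 => fun A => (\int[k z]_y kpow k n' y A)%E
  end.

Definition is_coupling (nu1 nu2 : set Z -> \bar R) (Pi : probability (Z * Z)%type R)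
  : Prop :=
  forall A : set Z, measurable A ->
    Pi (A `*` setT) = nu1 A /\ Pi (setT `*` A) = nu2 A.

Definition wasserstein (rho : Z -> Z -> R) (nu1 nu2 : set Z -> \bar R) : \bar R :=
  ereal_inf [set (\int[Pi]_p (rho p.1 p.2)%:E)%E
            | Pi in [set Pi | is_coupling nu1 nu2 Pi]].

Fixpoint fdd (k : R.-pker Z ~> Z) (As : seq (set Z)) (z : Z) : \bar R :=
  match As with
  | [::] => 1%E
  | A :: As' => (\int[k z]_(y in A) fdd k As' y)%E
  end.

Definition is_markov_chain {dO} {Omega : measurableType dO}
  (P : probability Omega R) (Zp : nat -> Omega -> Z)
  (k : R.-pker Z ~> Z) (mu : probability Z R) : Prop :=
  (forall n, measurable_fun setT (Zp n)) /\
  forall (A0 : set Z) (As : seq (set Z)), measurable A0 -> (forall i, (i < size As)%N -> measurable (nth setT As i)) ->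
    P [set w | A0 (Zp 0%N w) /\
               forall i, (i < size As)%N -> nth setT As i (Zp i.+1 w)]
    = (\int[mu]_(z in A0) fdd k As z)%E.

Definition invariant_measure (k : R.-pker Z ~> Z) (pi : probability Z R) : Prop :=
  forall A : set Z, measurable A -> pi A = (\int[pi]_z k z A)%E.

End Defs.

Section Learning.
Context {R : realType} {dX : measure_display} {X : measurableType dX}
  {d : measure_display} {Z : measurableType d}.

Definition loss_h (ell : R -> R -> R) (prX : Z -> X) (prY : Z -> R)
  (h : X -> R) (z : Z) : R := ell (h (prX z)) (prY z).

Definition er_pi (pi : probability Z R) (lh : (X -> R) -> Z -> R) (h : X -> R) : R :=
  Rintegral pi setT (lh h).

Definition opt_pi (pi : probability Z R) (lh : (X -> R) -> Z -> R)
  (H : set (X -> R)) : R :=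
  inf [set er_pi pi lh h | h in H].

Definition emp_err (lh : (X -> R) -> Z -> R) (h : X -> R) (s : seq Z) : R :=
  (size s)%:R^-1 * \sum_(z <- s) lh h z.

Definition is_ASEM (lh : (X -> R) -> Z -> R) (H : set (X -> R)) (eps : R)
  (A : seq Z -> (X -> R)) : Prop :=
  forall s : seq Z, (0 < size s)%N ->
    H (A s) /\ emp_err lh (A s) s < inf [set emp_err lh h s | h in H] + eps.

(** n_1(ε, δ); the radius ε/(4 L̄) is read as +oo when L̄ = 0 *)
Definition n1 (C1 C2 L Lbar eps delta : R) (H : set (X -> R))
  (rhoH : (X -> R) -> (X -> R) -> R) : R :=
  let r : \bar R := if Lbar == 0 then +oo%E else (eps / (4 * Lbar))%:E in
  Num.max (16 * C1 * L / (eps * (1 - expR (- C2))))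
          (128 * C1 ^+ 2 * L ^+ 2 * ln (covering_number H rhoH r / delta)
             / (eps ^+ 2 * (1 - expR (- C2)) ^+ 2)).

End Learning.

(* Main.v *)
Require Import Defs.
From HB Require Import structures.
From mathcomp Require Import all_boot all_order all_algebra.
From mathcomp Require Import all_classical all_reals all_analysis.
From mathcomp Require Import measurable_realfun ring lra.
Import Order.TTheory GRing.Theory Num.Theory.
Import numFieldNormedType.Exports.
Local Open Scope classical_set_scope.
Local Open Scope ring_scope.

(* Write [T] for the transition operator, [er] for the mean of a loss [f] under
   the invariant measure, and [K = C1 L / (1 - exp (- C2))].  The easy half of
   Kantorovich duality gives [|T^i f - er| <= L C1 exp (- C2 i)], so the partial
   sums [g_m] of the series [sum_i (T^i f - er)] are bounded by [K], and
   [g_(m+1) = (f - er) + T g_m].  Bounding [T exp (th g_m)] by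
   [exp (th T g_m + 8 (th K)^2)] and iterating along the chain yields an
   Azuma-type bound on the exponential moment of [sum_i (f (Z_i) - er)], hence a
   tail bound for each loss.  As only the law of the chain on cylinder sets is
   given, [exp (th f)] is first majorised by a simple function.

   A minimal covering by [N] balls and a union bound over the [2 N] tail events
   give uniform deviation at most [3 eps / 2].  The factor [2] is only affordable
   when [N >= 2]; for [N = 1] all hypotheses have errors within [eps / 2] of each
   other, and for [K <= eps] empirical and true errors always differ by at most
   [eps], so these two cases need no probability. *)

(** [expR (- x) >= 1 - x] gives [(1 - x) * expR x <= 1], while [1 - x] times the quadratic exceeds
    [1] by [x ^+ 2 * (1 - 2 * x)]. *)
Lemma expR_le_quadratic (R : realType) (x : R) :
  x <= 2^-1 -> expR x <= 1 + x + 2 * x ^+ 2.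
Proof.
move=> x_le; have := expR_ge1Dx (- x); rewrite expRN => hx.
have e0 : 0 < expR x := expR_gt0 x.
have : (1 - x) * expR x <= 1.
  by rewrite -ler_pdivlMr// div1r.
move=> h; have x1 : 0 < 1 - x by lra.
rewrite -(ler_pM2l x1); apply: (le_trans h).
have -> : (1 - x) * (1 + x + 2 * x ^+ 2) = 1 + x ^+ 2 * (1 - 2 * x) by ring.
by rewrite lerDl mulr_ge0 ?sqr_ge0//; lra.
Qed.

(** * Bounded measurable functions and their integrals against measures of mass one *)

Section BoundedMeasurable.
Context {R : realType} {d : measure_display} {T : measurableType d}.
Implicit Types (m : {measure set T -> \bar R}) (u v : T -> R).

(** A class stable under algebraic operations, [expR] and the kernel, on which integrals against a
    measure of mass one are finite; real-valued integration is then linear and monotone. *)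
Definition bounded_measurable u :=
  measurable_fun setT u /\ exists M, forall x, `|u x| <= M.

Lemma bounded_measurable_cst c : bounded_measurable (fun=> c).
Proof. by split; [exact: measurable_cst|exists `|c|]. Qed.

Lemma bounded_measurableD u v : bounded_measurable u -> bounded_measurable v ->
  bounded_measurable (fun x => u x + v x).
Proof.
move=> [mu [M hM]] [mv [N hN]]; split; first exact: measurable_funD.
by exists (M + N) => x; rewrite (le_trans (ler_normD _ _))// lerD.
Qed.

Lemma bounded_measurableZ c u : bounded_measurable u ->
  bounded_measurable (fun x => c * u x).
Proof.
move=> [mu [M hM]]; split; first exact: measurable_funM.
by exists (`|c| * M) => x; rewrite normrM ler_wpM2l.
Qed.

Lemma bounded_measurableM u v : bounded_measurable u -> bounded_measurable v ->
  bounded_measurable (fun x => u x * v x).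
Proof.
move=> [mu [M hM]] [mv [N hN]]; split; first exact: measurable_funM.
by exists (M * N) => x; rewrite normrM ler_pM.
Qed.

Lemma bounded_measurableB u v : bounded_measurable u -> bounded_measurable v ->
  bounded_measurable (fun x => u x - v x).
Proof.
move=> bu bv.
have := bounded_measurableD _ _ bu (bounded_measurableZ (-1) _ bv).
by under eq_fun do rewrite mulN1r.
Qed.

Lemma bounded_measurable_expR u : bounded_measurable u ->
  bounded_measurable (fun x => expR (u x)).
Proof.
move=> [mu [M hM]]; split; first exact: measurableT_comp.
exists (expR M) => x; rewrite ger0_norm ?expR_ge0// ler_expR.
exact: le_trans (ler_norm _) (hM x).
Qed.

(** Mass one is a hypothesis, rather than [m] being a [probability], so that [k z] is covered
    through [prob_kernel]. *)
Lemma bounded_measurable_integrable m u : m setT = 1%E ->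
  bounded_measurable u -> m.-integrable setT (EFin \o u).
Proof.
move=> m1 [mu [M hM]]; apply: measurable_bounded_integrable => //.
  by rewrite [X in (X < _)%E]m1 ltry.
exists M; split => //; first exact: num_real.
by move=> N MN x _; exact: le_trans (hM x) (ltW MN).
Qed.

Lemma Rintegral_prob_cst m c : m setT = 1%E -> \int[m]_x (fun=> c) x = c.
Proof. by move=> m1; rewrite Rintegral_cst// [X in fine X]m1 mulr1. Qed.

Lemma bounded_Rintegral m u a b : m setT = 1%E -> measurable_fun setT u ->
  (forall x, a <= u x <= b) -> a <= \int[m]_x u x <= b.
Proof.
move=> m1 mu hab.
have bu : bounded_measurable u.
  split=> //; exists (`|a| + `|b|) => x; have /andP[h1 h2] := hab x.
  have := ler_norm b; have := ler_norm (- a); rewrite normrN => *.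
  by rewrite ler_norml; have := normr_ge0 a; have := normr_ge0 b; lra.
have iu := bounded_measurable_integrable m u m1 bu.
have ic c := bounded_measurable_integrable m _ m1 (bounded_measurable_cst c).
rewrite -{1}(Rintegral_prob_cst m a m1) -[X in _ && (_ <= X)](Rintegral_prob_cst m b m1).
by apply/andP; split; apply: le_Rintegral => // x _; case/andP: (hab x).
Qed.

Lemma norm_Rintegral_le m u M : m setT = 1%E -> measurable_fun setT u ->
  (forall x, `|u x| <= M) -> `|\int[m]_x u x| <= M.
Proof.
move=> m1 mu hM; rewrite ler_norml; apply: bounded_Rintegral => // x.
by rewrite -ler_norml.
Qed.

End BoundedMeasurable.

(** * The transition operator and its iterates *)

Section KernelOperator.
Context {R : realType} {d : measure_display} {Z : measurableType d}.
Variable k : R.-pker Z ~> Z.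
Implicit Types (u v : Z -> R).

Definition ktrans u (z : Z) : R := \int[k z]_y u y.

Lemma EFin_ktrans u z : bounded_measurable u ->
  (ktrans u z)%:E = (\int[k z]_y (u y)%:E)%E.
Proof.
move=> bu; rewrite /ktrans /Rintegral fineK//.
exact: integrable_fin_num (bounded_measurable_integrable _ _ (prob_kernel z) bu).
Qed.

Lemma ktransD u v z : bounded_measurable u -> bounded_measurable v ->
  ktrans (fun x => u x + v x) z = ktrans u z + ktrans v z.
Proof.
by move=> bu bv; apply: RintegralD => //;
   apply: bounded_measurable_integrable => //; exact: prob_kernel.
Qed.

Lemma ktransB u v z : bounded_measurable u -> bounded_measurable v ->
  ktrans (fun x => u x - v x) z = ktrans u z - ktrans v z.
Proof.
by move=> bu bv; apply: RintegralB => //;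
   apply: bounded_measurable_integrable => //; exact: prob_kernel.
Qed.

Lemma ktransZ c u z : bounded_measurable u ->
  ktrans (fun x => c * u x) z = c * ktrans u z.
Proof.
by move=> bu; apply: RintegralZl => //;
   apply: bounded_measurable_integrable => //; exact: prob_kernel.
Qed.

Lemma ktrans_cst c z : ktrans (fun=> c) z = c.
Proof. exact/Rintegral_prob_cst/prob_kernel. Qed.

Lemma ktrans_le u v z : bounded_measurable u -> bounded_measurable v ->
  (forall x, u x <= v x) -> ktrans u z <= ktrans v z.
Proof.
by move=> bu bv uv; apply: le_Rintegral => //;
   apply: bounded_measurable_integrable => //; exact: prob_kernel.
Qed.

Lemma ktrans_norm_le u M z : measurable_fun setT u ->
  (forall x, `|u x| <= M) -> `|ktrans u z| <= M.
Proof. by move=> mu hM; apply: norm_Rintegral_le => //; exact: prob_kernel. Qed.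

(** Measurability of kernel integrals is applied to the nonnegative function [u + M]; since the
    operator fixes constants, [M] is subtracted afterwards. *)
Lemma bounded_measurable_ktrans u : bounded_measurable u ->
  bounded_measurable (ktrans u).
Proof.
move=> bu; have [mu [M hM]] := bu; split; last first.
  by exists M => z; exact: ktrans_norm_le.
have bv : bounded_measurable (fun x => u x + M).
  exact: bounded_measurableD bu (bounded_measurable_cst M).
rewrite (_ : ktrans u = (fun z => ktrans (fun x => u x + M) z - M)); last first.
  apply/funext => z; rewrite ktransD ?ktrans_cst ?addrK//.
  exact: bounded_measurable_cst.
apply: measurable_funB => //; apply/measurable_EFinP.
rewrite (_ : EFin \o _ = (fun z => \int[k z]_y (u y + M)%:E)%E); last first.
  by apply/funext => z; rewrite /= EFin_ktrans.
apply: measurable_fun_integral_kernel => //.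
- by move=> U mU; exact: measurable_kernel.
- move=> z; rewrite lee_fin; have := hM z; rewrite ler_norml => /andP[+ _]; lra.
- by apply/measurable_EFinP; case: bv.
Qed.

Lemma bounded_measurable_iter_ktrans u n : bounded_measurable u ->
  bounded_measurable (iter n ktrans u).
Proof. by move=> bu; elim: n => //= n; exact: bounded_measurable_ktrans. Qed.

Lemma ge0_integral_kcomp_noparam (k1 k2 : R.-spker Z ~> Z) z (u : Z -> \bar R) :
  (forall x, (0 <= u x)%E) -> measurable_fun setT u ->
  (\int[mkcomp_noparam k1 k2 z]_x u x = \int[k1 z]_y \int[k2 y]_x u x)%E.
Proof.
move=> u0 mu.
have h := integral_kcomp k1 (kernel.kernel_snd k2) z u0 mu.
exact: h.
Qed.

(** [kpow] is only a family of set functions. Composing kernels yields genuine measures with the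
    same values, against which one can integrate. *)
Lemma kpow_kernel n : exists kn : R.-spker Z ~> Z,
  (forall z A, kn z A = kpow k n z A) /\
  forall z u, bounded_measurable u -> (forall x, 0 <= u x) ->
    (\int[kn z]_x (u x)%:E = (iter n ktrans u z)%:E)%E.
Proof.
elim: n => [|n [kn [knE kn_int]]].
  exists (kdirac (@measurable_id _ Z setT)); split => //= z u [mu _] u0.
  rewrite integral_dirac//; last exact/measurable_EFinP.
  by rewrite diracT mul1e.
exists (mkcomp_noparam k kn); split.
  by move=> z A /=; apply: eq_integral => y _; rewrite knE.
move=> z u bu u0; rewrite ge0_integral_kcomp_noparam//; last first.
  by apply/measurable_EFinP; case: bu.
rewrite /= EFin_ktrans; last exact: bounded_measurable_iter_ktrans.
by apply: eq_integral => y _; rewrite kn_int.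
Qed.

End KernelOperator.

(** * Monotonicity and change of variables for integrals *)

Section IntegralComparison.
Context {R : realType} {d : measure_display} {T : measurableType d}.
Implicit Types (m : {measure set T -> \bar R}).

Lemma ge0_le_integralT m (f g : T -> \bar R) :
  (forall x, (0 <= f x)%E) -> (forall x, (f x <= g x)%E) ->
  (\int[m]_x f x <= \int[m]_x g x)%E.
Proof.
move=> f0 fg; rewrite !ge0_integralTE//; last first.
  by move=> x; exact: le_trans (f0 x) (fg x).
apply: le_ereal_sup => _ [h hf <-]; exists h => // x.
exact: le_trans (hf x) (fg x).
Qed.

(** Meant for the marginals of a coupling: [is_coupling] identifies them with images under the
    projections on measurable sets only. *)
Lemma Rintegral_image_measure {d' : measure_display} {U : measurableType d'}
    m (m' : {measure set U -> \bar R}) (phi : T -> U) (u : U -> R) :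
  m setT = 1%E -> measurable_fun setT phi ->
  (forall A, measurable A -> m (phi @^-1` A) = m' A) ->
  bounded_measurable u -> \int[m']_y u y = \int[m]_x u (phi x).
Proof.
move=> m1 mphi mE [mu [M hM]].
pose phi' : {mfun T >-> U} :=
  HB.pack phi (isMeasurableFun.Build _ _ _ _ _ mphi).
rewrite /Rintegral; congr fine.
transitivity (\int[pushforward m phi']_y (u y)%:E)%E.
  by apply: eq_measure_integral => A mA _; rewrite -mE.
rewrite integral_pushforward//; first exact/measurable_EFinP.
rewrite preimage_setT; apply: (bounded_measurable_integrable m (u \o phi)) => //.
by split; [exact: measurableT_comp|exists M => x; exact: hM].
Qed.

End IntegralComparison.

(** * The easy half of Kantorovich duality, and geometric ergodicity of the iterates *)

Section Kantorovich.
Context {R : realType} {d : measure_display} {T : measurableType d}.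
Implicit Types (m : {measure set T -> \bar R}).

(* [ge0_le_integralT] is what compares the transport cost with an arbitrary [rho]:
   the integral of a nonnegative function is monotone even without measurability. *)
Lemma wasserstein_lipschitz (rho : T -> T -> R) (L w : R) (u : T -> R) m1 m2 :
  bounded_measurable u -> 0 <= L ->
  (forall x y, `|u x - u y| <= L * rho x y) ->
  (wasserstein rho m1 m2 <= w%:E)%E ->
  `|\int[m1]_x u x - \int[m2]_x u x| <= L * w.
Proof.
move=> bu L0 hL hw; apply/ler_addgt0Pr => e e0.
(* The infimum over couplings need not be attained, so a coupling within [e'] of [w] is used;
   [L + 1] keeps the division meaningful for [L = 0] and still gives [L * e' <= e]. *)
pose e' := e / (L + 1).
have e'0 : 0 < e' by rewrite divr_gt0//; lra.
have /ereal_inf_lt[_ [Pi /= cPi <-] hPi] : (wasserstein rho m1 m2 < (w + e')%:E)%E.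
  by rewrite (le_lt_trans hw)// lte_fin ltrDl.
have Pi1 : Pi setT = 1%E := probability_setT Pi.
have int1 : \int[m1]_x u x = \int[Pi]_p u p.1.
  apply: (Rintegral_image_measure Pi m1 fst) => // A mA.
  by rewrite -setXT; case: (cPi A mA).
have int2 : \int[m2]_x u x = \int[Pi]_p u p.2.
  apply: (Rintegral_image_measure Pi m2 snd) => // A mA.
  by rewrite -setTX; case: (cPi A mA).
have [mu [M hM]] := bu.
have b1 : bounded_measurable (fun p : T * T => u p.1).
  by split; [exact: measurableT_comp|exists M].
have b2 : bounded_measurable (fun p : T * T => u p.2).
  by split; [exact: measurableT_comp|exists M].
have bv := bounded_measurableB _ _ b1 b2.
have bav : bounded_measurable (fun p : T * T => `|u p.1 - u p.2|).
  split; first by apply: measurableT_comp => //; case: bv.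
  by case: bv => _ [N hN]; exists N => p; rewrite normr_id.
have bi v := bounded_measurable_integrable Pi v Pi1.
rewrite int1 int2 -RintegralB//; [|exact: bi|exact: bi].
apply: le_trans (le_normr_Rintegral _ _) _ => //; first exact: bi.
(* For [L > 0] the integrand is divided by [L] and compared with [rho] itself, so that no scalar has
   to leave the integral of the arbitrary function [rho]. *)
have [L_eq0|L_neq0] := eqVneq L 0.
  rewrite (_ : (fun p => `| _ |) = fun=> 0); last first.
    by apply/funext => p; apply/eqP; rewrite -normr_le0 normr_id;
      have := hL p.1 p.2; rewrite L_eq0 mul0r.
  by rewrite (Rintegral_prob_cst Pi 0)// L_eq0 mul0r add0r ltW.
have Lpos : 0 < L by rewrite lt_neqAle eq_sym L_neq0.
have : \int[Pi]_p (L^-1 * `|u p.1 - u p.2|) <= w + e'.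
  rewrite -lee_fin /Rintegral fineK; last first.
    by apply: integrable_fin_num => //; apply: bi; exact: bounded_measurableZ.
  apply: le_trans (ltW hPi); apply: ge0_le_integralT => p.
    by rewrite lee_fin mulr_ge0// invr_ge0.
  by rewrite lee_fin mulrC ler_pdivrMr// mulrC.
rewrite RintegralZl//; last exact: bi.
rewrite mulrC ler_pdivrMr// => /le_trans; apply.
rewrite mulrDl mulrC lerD2l /e' -mulrA ler_piMr ?(ltW e0)//.
by rewrite mulrC ler_pdivrMr; lra.
Qed.

End Kantorovich.

Section Ergodicity.
Context {R : realType} {d : measure_display} {Z : measurableType d}.
Variables (k : R.-pker Z ~> Z) (pi : probability Z R) (rho : Z -> Z -> R).

Lemma iter_ktrans_ergodic (L w : R) (u : Z -> R) n z :
  bounded_measurable u -> (forall x, 0 <= u x) -> 0 <= L ->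
  (forall x y, `|u x - u y| <= L * rho x y) ->
  (wasserstein rho (kpow k n z) pi <= w%:E)%E ->
  `|iter n (ktrans k) u z - \int[pi]_x u x| <= L * w.
Proof.
move=> bu u0 L0 hL hw; have [kn [knE kn_int]] := kpow_kernel k n.
have -> : iter n (ktrans k) u z = \int[kn z]_x u x.
  by rewrite /Rintegral kn_int.
apply: wasserstein_lipschitz hL _ => //.
by rewrite (_ : (kn z : set Z -> \bar R) = kpow k n z)//; apply/funext => A.
Qed.

End Ergodicity.

(** * Exponential moments along the chain *)

Section ExponentialMoment.
Context {R : realType} {d : measure_display} {Z : measurableType d}.
Variable k : R.-pker Z ~> Z.

(** After centring [u] at its mean [c], the exponent is at most [2 * (th * K) <= 1 / 2] in absolute
    value. In the quadratic bound for [expR] the linear term integrates to zero and the square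
    contributes [2 * 4 = 8] times [(th * K) ^+ 2]. *)
Lemma ktrans_expR_le (u : Z -> R) (K th : R) z :
  bounded_measurable u -> (forall x, `|u x| <= K) -> 0 <= th ->
  th * K <= 4^-1 ->
  ktrans k (fun x => expR (th * u x)) z
    <= expR (th * ktrans k u z + 8 * (th * K) ^+ 2).
Proof.
move=> bu hu th0 thK.
set c := ktrans k u z; pose v x := u x - c.
have hc : `|c| <= K by apply: ktrans_norm_le => //; case: bu.
have bv : bounded_measurable v.
  exact: bounded_measurableB bu (bounded_measurable_cst c).
have hv x : `|th * v x| <= 2 * (th * K).
  rewrite normrM ger0_norm// mulrCA ler_wpM2l//.
  by rewrite (le_trans (ler_normB _ _))//; have := hu x; lra.
have expE : (fun x => expR (th * u x)) =
    (fun x => expR (th * c) * expR (th * v x)).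
  by apply/funext => x; rewrite -expRD -mulrDr /v addrCA subrr addr0.
have be : bounded_measurable (fun x => expR (th * v x)).
  exact: bounded_measurable_expR (bounded_measurableZ th _ bv).
rewrite expE ktransZ// expRD ler_wpM2l ?expR_ge0//.
apply: le_trans (expR_ge1Dx _).
have -> : 1 + 8 * (th * K) ^+ 2 =
    ktrans k (fun x => (1 + 8 * (th * K) ^+ 2) + th * v x) z.
  rewrite ktransD ?ktrans_cst; [|exact: bounded_measurable_cst|exact: bounded_measurableZ].
  rewrite ktransZ// ktransB ?ktrans_cst//; last exact: bounded_measurable_cst.
  by rewrite subrr mulr0 addr0.
apply: ktrans_le => //.
  by apply: bounded_measurableD (bounded_measurable_cst _) _; exact: bounded_measurableZ.
move=> x; have hvx := hv x.
apply: le_trans (expR_le_quadratic _ _ _) _.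
  by have := ler_norm (th * v x); lra.
have : (th * v x) ^+ 2 <= (2 * (th * K)) ^+ 2.
  by rewrite -real_normK ?num_real// lerXn2r// nnegrE ?normr_ge0//; exact: le_trans hvx.
rewrite exprMn; lra.
Qed.

(** The expectation, for the chain started at a point, of the product of [g] over times [1] to [n];
    the factor at time [0] is left out. *)
Fixpoint kprod (g : Z -> R) (n : nat) : Z -> R :=
  if n is n'.+1 then ktrans k (fun y => g y * kprod g n' y) else fun=> 1.

Lemma bounded_measurable_kprod g n : bounded_measurable g ->
  bounded_measurable (kprod g n).
Proof.
move=> bg; elim: n => [|n ih] /=; first exact: bounded_measurable_cst.
exact/bounded_measurable_ktrans/bounded_measurableM.
Qed.

(* [kpsum w n] truncates the solution [g] of the Poisson equation [g - ktrans g = w]. *)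
Definition kpsum (w : Z -> R) n z := \sum_(i < n) iter i (ktrans k) w z.

Lemma bounded_measurable_kpsum w n : bounded_measurable w ->
  bounded_measurable (kpsum w n).
Proof.
move=> bw; elim: n => [|n ih].
  rewrite (_ : kpsum w 0 = fun=> 0); first exact: bounded_measurable_cst.
  by apply/funext => z; rewrite /kpsum big_ord0.
rewrite (_ : kpsum w n.+1 = fun z => kpsum w n z + iter n (ktrans k) w z).
  exact: bounded_measurableD ih (bounded_measurable_iter_ktrans _ _ _ bw).
by apply/funext => z; rewrite /kpsum big_ord_recr.
Qed.

Lemma kpsumS w n z : bounded_measurable w ->
  kpsum w n.+1 z = w z + ktrans k (kpsum w n) z.
Proof.
move=> bw; rewrite {1}/kpsum big_ord_recl /=; congr (_ + _).
elim: n => [|n ih].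
  rewrite big_ord0 (_ : kpsum w 0 = fun=> 0) ?ktrans_cst//.
  by apply/funext => x; rewrite /kpsum big_ord0.
rewrite big_ord_recr /= ih.
rewrite (_ : kpsum w n.+1 = fun z => kpsum w n z + iter n (ktrans k) w z).
  rewrite ktransD//; first exact: bounded_measurable_kpsum.
  exact: bounded_measurable_iter_ktrans.
by apply/funext => x; rewrite /kpsum big_ord_recr.
Qed.

(** By induction, each application of [ktrans] costs a factor [expR (8 * (th * K) ^+ 2)] by
    [ktrans_expR_le], and [kpsumS] merges the new [w z] with [ktrans k (kpsum w n.+1) z] into the
    next partial sum. The slack [s] is the error of a simple majorant [g]. *)
Lemma mul_kprod_le (g w : Z -> R) (K th s : R) n z :
  bounded_measurable g -> bounded_measurable w ->
  (forall x, 0 <= g x <= expR (th * (w x + s))) ->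
  (forall m x, `|kpsum w m x| <= K) -> 0 <= th -> th * K <= 4^-1 ->
  g z * kprod g n z <=
    expR (n.+1%:R * (th * s + 8 * (th * K) ^+ 2) + th * kpsum w n.+1 z).
Proof.
move=> bg bw hg hK th0 thK; set c := th * s + _.
have c8 : th * s <= c by rewrite lerDl mulr_ge0// sqr_ge0.
elim: n z => [|n ih] z.
  rewrite /= mulr1 mul1r; have /andP[_ /le_trans] := hg z; apply.
  by rewrite ler_expR /kpsum big_ord_recl big_ord0 addr0 /= mulrDr; lra.
have bp := bounded_measurable_kprod g n bg.
have bps := bounded_measurable_kpsum w n.+1 bw.
have /andP[g0 gle] := hg z.
apply: (@le_trans _ _ (expR (th * (w z + s)) *
  expR (n.+1%:R * c + (th * ktrans k (kpsum w n.+1) z + 8 * (th * K) ^+ 2)))).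
  apply: ler_pM => //.
    rewrite -(ktrans_cst k 0 z); apply: ktrans_le.
    - exact: bounded_measurable_cst.
    - exact: bounded_measurableM.
    - move=> x; have /andP[gx0 _] := hg x; rewrite mulr_ge0//.
      elim: n {ih bp bps} x {gx0} => //= m ihm x.
      by apply: Rintegral_ge0 => y _; rewrite mulr_ge0//; case/andP: (hg y).
  rewrite /= expRD; apply: (@le_trans _ _ (ktrans k (fun x =>
     expR (n.+1%:R * c) * expR (th * kpsum w n.+1 x)) z)).
    apply: ktrans_le; first exact: bounded_measurableM.
    - by apply/bounded_measurableZ/bounded_measurable_expR/bounded_measurableZ.
    - by move=> x; rewrite -expRD; exact: ih.
  rewrite ktransZ; last exact/bounded_measurable_expR/bounded_measurableZ.
  by rewrite ler_wpM2l ?expR_ge0//; exact: ktrans_expR_le.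
rewrite -expRD ler_expR (kpsumS _ n.+1)// -natr1 /c.
by rewrite le_eqVlt; apply/orP; left; apply/eqP; ring.
Qed.

End ExponentialMoment.

(** * Finite sums and products of bounded measurable functions *)

Section FiniteSums.
Context {R : realType} {d : measure_display} {T : measurableType d}.

Lemma bounded_measurable_sum (N : nat) (c : 'I_N -> R) (phi : 'I_N -> T -> R) :
  (forall j, bounded_measurable (phi j)) ->
  bounded_measurable (fun x => \sum_(j < N) c j * phi j x).
Proof.
elim: N c phi => [|N ih] c phi bphi.
  by under eq_fun do rewrite big_ord0; exact: bounded_measurable_cst.
under eq_fun do rewrite big_ord_recr.
apply: bounded_measurableD; first by apply: ih => j; exact: bphi.
exact: bounded_measurableZ.
Qed.

Lemma bounded_measurable_prod (n : nat) (phi : nat -> T -> R) :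
  (forall j, bounded_measurable (phi j)) ->
  bounded_measurable (fun x => \prod_(j < n) phi j x).
Proof.
move=> bphi; elim: n => [|n ih].
  by under eq_fun do rewrite big_ord0; exact: bounded_measurable_cst.
by under eq_fun do rewrite big_ord_recr; exact: bounded_measurableM.
Qed.

Lemma bounded_measurable_indic (A : set T) : measurable A ->
  bounded_measurable (\1_A : T -> R).
Proof.
move=> mA; split; first exact: measurable_indic.
by exists 1 => x; rewrite indicE; case: (x \in A); rewrite ?normr1 ?normr0.
Qed.

Lemma Rintegral_sum (m : {measure set T -> \bar R}) (N : nat) (c : 'I_N -> R)
    (phi : 'I_N -> T -> R) : m setT = 1%E ->
  (forall j, bounded_measurable (phi j)) ->
  \int[m]_x (\sum_(j < N) c j * phi j x) = \sum_(j < N) c j * \int[m]_x phi j x.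
Proof.
move=> m1; elim: N c phi => [|N ih] c phi bphi.
  under eq_Rintegral do rewrite big_ord0.
  by rewrite big_ord0 (Rintegral_prob_cst m 0).
under eq_Rintegral do rewrite big_ord_recr.
rewrite /= RintegralD//; last 2 first.
- by apply: bounded_measurable_integrable => //; apply: bounded_measurable_sum.
- by apply: bounded_measurable_integrable => //; apply: bounded_measurableZ.
rewrite big_ord_recr ih//= RintegralZl//.
exact: bounded_measurable_integrable.
Qed.

End FiniteSums.

(** * Expectations of products along the chain, from cylinder probabilities *)

Section ChainExpectation.
Context {R : realType} {d : measure_display} {Z : measurableType d}.
Variable k : R.-pker Z ~> Z.

(** For the chain started at a point, the expectation of [phi] at time [size As] on the event that
    the sets of [As] are visited at times [1] to [size As]. *)
Definition kcyl (As : seq (set Z)) (phi : Z -> R) : Z -> R :=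
  foldr (fun A F => ktrans k (fun y => \1_A y * F y)) phi As.

Definition measurable_seq (As : seq (set Z)) :=
  forall i, (i < size As)%N -> measurable (nth setT As i).

Lemma measurable_seq_cons A As :
  measurable_seq (A :: As) -> measurable A /\ measurable_seq As.
Proof. by move=> h; split; [exact: (h 0%N)|move=> i hi; exact: (h i.+1)]. Qed.

Lemma measurable_seq_rcons As A :
  measurable_seq As -> measurable A -> measurable_seq (rcons As A).
Proof.
move=> mAs mA i; rewrite size_rcons ltnS nth_rcons => iAs.
by case: ltngtP iAs => // hi _; exact: mAs.
Qed.

Lemma kcyl_rcons As A phi :
  kcyl (rcons As A) phi = kcyl As (ktrans k (fun y => \1_A y * phi y)).
Proof. by rewrite /kcyl foldr_rcons. Qed.

Lemma bounded_measurable_kcyl As phi : measurable_seq As ->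
  bounded_measurable phi -> bounded_measurable (kcyl As phi).
Proof.
move=> + bphi; elim: As => [|A As ih]//= /measurable_seq_cons[mA /ih bF].
exact/bounded_measurable_ktrans/bounded_measurableM/bF/bounded_measurable_indic.
Qed.

Lemma ktrans_sum (N : nat) (c : 'I_N -> R) (phi : 'I_N -> Z -> R) z :
  (forall j, bounded_measurable (phi j)) ->
  ktrans k (fun x => \sum_(j < N) c j * phi j x) z =
  \sum_(j < N) c j * ktrans k (phi j) z.
Proof. by move=> bphi; apply: Rintegral_sum => //; exact: prob_kernel. Qed.

Lemma kcyl_sum As (N : nat) (c : 'I_N -> R) (phi : 'I_N -> Z -> R) :
  measurable_seq As -> (forall j, bounded_measurable (phi j)) ->
  kcyl As (fun x => \sum_(j < N) c j * phi j x) =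
  (fun x => \sum_(j < N) c j * kcyl As (phi j) x).
Proof.
move=> + bphi; elim: As => [|A As ih]//= /measurable_seq_cons[mA mAs].
rewrite ih//; apply/funext => z; rewrite -ktrans_sum; last first.
  move=> j; apply/bounded_measurableM/bounded_measurable_kcyl => //.
  exact: bounded_measurable_indic.
by congr ktrans; apply/funext => y; rewrite mulr_sumr; apply: eq_bigr => j _;
  rewrite mulrCA.
Qed.

Lemma fddE As z : measurable_seq As ->
  fdd k As z = (kcyl As (fun=> 1) z)%:E.
Proof.
elim: As z => [|A As ih] z //= /measurable_seq_cons[mA mAs].
rewrite EFin_ktrans; last first.
  apply: bounded_measurableM; first exact: bounded_measurable_indic.
  exact: bounded_measurable_kcyl (bounded_measurable_cst _).
rewrite integral_mkcond; apply: eq_integral => y _.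
by rewrite patchE indicE; case: ifPn => yA; rewrite ?mul1r ?mul0r ?ih.
Qed.

Context {dO : measure_display} {Omega : measurableType dO}.
Variables (P : probability Omega R) (Zp : nat -> Omega -> Z) (mu : probability Z R).
Hypothesis chainP : is_markov_chain P Zp k mu.

Definition cylinder (A0 : set Z) (As : seq (set Z)) : set Omega :=
  [set w | A0 (Zp 0%N w) /\
           forall i, (i < size As)%N -> nth setT As i (Zp i.+1 w)].

Lemma cylinder_rcons A0 As A :
  cylinder A0 (rcons As A) = cylinder A0 As `&` Zp (size As).+1 @^-1` A.
Proof.
apply/seteqP; split => w.
  move=> [w0 wAs]; split; last first.
    by have := wAs (size As); rewrite size_rcons ltnS leqnn nth_rcons ltnn eqxx; exact.
  split => // i hi; have := wAs i; rewrite size_rcons nth_rcons hi; apply.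
  by rewrite ltnS ltnW.
move=> [[w0 wAs] wA]; split => // i; rewrite size_rcons ltnS nth_rcons.
by case: ltngtP => // [hi _|-> _]; [exact: wAs|].
Qed.

Lemma measurable_cylinder A0 As : measurable A0 -> measurable_seq As ->
  measurable (cylinder A0 As).
Proof.
have [mZp _] := chainP.
have mpre n A : measurable A -> measurable (Zp n @^-1` A).
  by move=> mA; rewrite -[X in measurable X]setTI; exact: mZp.
move=> mA0; elim/last_ind: As => [_|As A ih mAs].
  rewrite (_ : cylinder _ _ = Zp 0%N @^-1` A0); first exact: mpre.
  by apply/seteqP; split => w; [case|move=> w0; split].
rewrite cylinder_rcons; apply: measurableI; last first.
  by apply: mpre; have := mAs (size As); rewrite size_rcons nth_rcons ltnn eqxx; exact.
apply: ih => i hi; have := mAs i; rewrite size_rcons nth_rcons hi; apply.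
by rewrite ltnS ltnW.
Qed.

Variables (N : nat) (c : 'I_N -> R) (B : 'I_N -> set Z).
Hypothesis mB : forall j, measurable (B j).

(** For a combination of indicators, the expectation of a product along the chain is a combination
    of cylinder probabilities, which [is_markov_chain] prescribes. *)
Let g (z : Z) : R := \sum_(j < N) c j * \1_(B j) z.

Let bg : bounded_measurable g.
Proof. by apply: bounded_measurable_sum => j; exact: bounded_measurable_indic. Qed.

Let bgZp i : bounded_measurable (g \o Zp i).
Proof.
have [mZp _] := chainP; have [mg [M hM]] := bg.
by split; [exact: measurableT_comp|exists M => w; exact: hM].
Qed.

(** The cylinder occupies times [0] to [size As]. The first factor of the product sits at the next
    time; expanding it into indicators lengthens the cylinder by one [B i], hence the induction with
    [As] general. *)
Lemma chain_expectation_cylinder A0 As n : measurable A0 -> measurable_seq As ->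
  \int[P]_w (\1_(cylinder A0 As) w * \prod_(j < n) g (Zp ((size As).+1 + j)%N w))
  = \int[mu]_z (\1_A0 z * kcyl As (kprod k g n) z).
Proof.
elim: n As => [|n ih] As mA0 mAs.
  have [_ /(_ A0 As mA0 mAs)] := chainP.
  rewrite -/(cylinder A0 As) /Rintegral => PE; congr fine.
  transitivity (P (cylinder A0 As)).
    under eq_integral do rewrite big_ord0 mulr1.
    by rewrite integral_indic// ?setIT//; exact: measurable_cylinder.
  rewrite PE (integral_mkcond A0); apply: eq_integral => z _.
  by rewrite patchE indicE fddE//; case: ifPn => _; rewrite ?mul1r ?mul0r.
have mcyl := measurable_cylinder A0 As mA0 mAs.
have -> : (fun w => \1_(cylinder A0 As) w *
      \prod_(j < n.+1) g (Zp ((size As).+1 + j)%N w)) =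
    (fun w => \sum_(i < N) c i * (\1_(cylinder A0 (rcons As (B i))) w *
      \prod_(j < n) g (Zp ((size (rcons As (B i))).+1 + j)%N w))).
  apply/funext => w; rewrite big_ord_recl addn0 {1}/g mulrA mulr_sumr mulr_suml.
  apply: eq_bigr => i _; rewrite cylinder_rcons indicI size_rcons /=.
  rewrite (mulrCA _ (c i)) -!mulrA; congr (_ * (_ * (_ * _))).
  by apply: eq_bigr => j _; rewrite /bump /= add1n addnS addSn.
rewrite Rintegral_sum//; last 2 first.
- exact: probability_setT.
- move=> i; apply: bounded_measurableM.
    apply: bounded_measurable_indic; apply: measurable_cylinder => //.
    exact: measurable_seq_rcons.
  exact: (bounded_measurable_prod n (fun j => g \o Zp ((size (rcons As (B i))).+1 + j)%N)).
have bp := bounded_measurable_kprod k g n bg.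
have bBp i : bounded_measurable (fun y => \1_(B i) y * kprod k g n y).
  by apply: bounded_measurableM => //; exact: bounded_measurable_indic.
rewrite /= (_ : ktrans k _ = fun z => \sum_(i < N) c i *
    ktrans k (fun y => \1_(B i) y * kprod k g n y) z); last first.
  apply/funext => z; rewrite -ktrans_sum//; congr ktrans; apply/funext => y.
  by rewrite /g mulr_suml; apply: eq_bigr => i _; rewrite mulrA.
rewrite kcyl_sum//; last by move=> i; exact: bounded_measurable_ktrans.
transitivity (\int[mu]_z \sum_(i < N) c i * (\1_A0 z *
    kcyl (rcons As (B i)) (kprod k g n) z)); last first.
  apply: eq_Rintegral => z _; rewrite mulr_sumr; apply: eq_bigr => i _.
  by rewrite kcyl_rcons mulrCA.
rewrite Rintegral_sum; last 2 first.
- exact: probability_setT.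
- move=> i; apply: bounded_measurableM; first exact: bounded_measurable_indic.
  by apply: bounded_measurable_kcyl => //; exact: measurable_seq_rcons.
by apply: eq_bigr => i _; rewrite ih//; exact: measurable_seq_rcons.
Qed.

(** The factor at time [0] is expanded in the same way, each [B i] serving as the initial set of a
    cylinder with no further constraint. *)
Lemma chain_expectation n :
  \int[P]_w (\prod_(j < n.+1) g (Zp j w)) = \int[mu]_z (g z * kprod k g n z).
Proof.
have -> : (fun w => \prod_(j < n.+1) g (Zp j w)) =
    (fun w => \sum_(i < N) c i * (\1_(cylinder (B i) [::]) w *
      \prod_(j < n) g (Zp ((@size (set Z) [::]).+1 + j)%N w))).
  apply/funext => w; rewrite big_ord_recl {1}/g mulr_suml.
  apply: eq_bigr => i _; rewrite -mulrA; congr (_ * (_ * _)).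
  rewrite !indicE; congr (_%:R); congr nat_of_bool; apply/idP/idP => /[!inE].
    by move=> h; split.
  by case.
rewrite Rintegral_sum//; last 2 first.
- exact: probability_setT.
- move=> i; apply: bounded_measurableM.
    by apply: bounded_measurable_indic; exact: measurable_cylinder.
  exact: (bounded_measurable_prod n (fun j => g \o Zp ((@size (set Z) [::]).+1 + j)%N)).
have -> : (fun z => g z * kprod k g n z) =
    (fun z => \sum_(i < N) c i * (\1_(B i) z * kprod k g n z)).
  apply/funext => z; rewrite {1}/g mulr_suml.
  by apply: eq_bigr => i _; rewrite mulrA.
rewrite Rintegral_sum; last 2 first.
- exact: probability_setT.
- move=> i; apply: bounded_measurableM; first exact: bounded_measurable_indic.
  exact: bounded_measurable_kprod.
by apply: eq_bigr => i _; rewrite chain_expectation_cylinder.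
Qed.

End ChainExpectation.

(** * Measurability of Lipschitz functions, and simple majorants *)

(** Strict superlevel sets are [rho]-open: within radius [(f z - a) / (L + 1)] of [z], the function
    drops by less than [f z - a], also when [L = 0]. *)
Lemma lipschitz_measurable (R : realType) (d : measure_display)
    (Z : measurableType d) (rho : Z -> Z -> R) (L : R) (f : Z -> R) :
  is_borel_of rho -> 0 <= L ->
  (forall x y, `|f x - f y| <= L * rho x y) -> measurable_fun setT f.
Proof.
move=> borel L0 hf; apply: (measurability _ (RGenOInfty.measurableE R)).
move=> _ [_ [a ->] <-]; rewrite setTI [measurable]borel.
apply: sub_sigma_algebra => z /=; rewrite in_itv/= andbT => az.
exists ((f z - a) / (L + 1)) => [|y zy]; first by rewrite divr_gt0//; lra.
rewrite in_itv/= andbT.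
have L1 : 0 < L + 1 by lra.
have h1 : L * rho z y <= L * ((f z - a) / (L + 1)) by rewrite ler_wpM2l// ltW.
have h2 : L * ((f z - a) / (L + 1)) < f z - a.
  rewrite mulrA ltr_pdivrMr//; nra.
by have := hf z y; have := ler_norm (f z - f y); lra.
Qed.

(** The range of [w] is cut into intervals of length [s] starting at [- M]; on each, [w] is rounded
    up to the right endpoint. Only the term indexed by [Num.truncn (x z)] survives at [z]. *)
Lemma simple_expR_majorant (R : realType) (d : measure_display)
    (Z : measurableType d) (w : Z -> R) (th s : R) :
  bounded_measurable w -> 0 <= th -> 0 < s ->
  exists N (c : 'I_N -> R) (B : 'I_N -> set Z), (forall j, measurable (B j)) /\
    forall z, expR (th * w z) <= \sum_(j < N) c j * \1_(B j) z
              <= expR (th * (w z + s)).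
Proof.
move=> [mw [M hM]] th0 s0.
pose x z := (w z + M) / s.
have x0 z : 0 <= x z.
  by rewrite divr_ge0 ?(ltW s0)//; have := hM z; rewrite ler_norml; lra.
pose N := (Num.truncn (2 * M / s)).+1.
have xN z : (Num.truncn (x z) < N)%N.
  rewrite ltnS; apply: le_truncn; rewrite ler_pM2r ?invr_gt0//.
  by have := hM z; rewrite ler_norml; lra.
exists N, (fun j => expR (th * (j.+1%:R * s - M))),
  (fun j => x @^-1` [set` `[(j%:R : R), j.+1%:R[]).
split=> [j|z].
  rewrite -[X in measurable X]setTI.
  have mx : measurable_fun setT x.
    by apply: measurable_funM => //; exact: measurable_funD.
  exact: mx.
rewrite (bigD1 (Ordinal (xN z)))//= big1 ?addr0; last first.
  move=> j jz; rewrite indicE memNset ?mulr0//= in_itv/= => jx.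
  by move/eqP: jz; apply; apply: val_inj; rewrite /= (truncn_def jx).
have /andP[h1 h2] := truncn_itv (x0 z).
rewrite indicE mem_set/= ?in_itv/= ?h1// mulr1 !ler_expR.
move: h1 h2; rewrite /x ler_pdivlMr// ltr_pdivrMr// => h1 h2.
by rewrite -natr1 in h2 *; apply/andP; split; apply: ler_wpM2l => //; lra.
Qed.

(** * Chernoff bound for sums along the chain, and the choice of its parameters *)

Section Concentration.
Context {R : realType} {d : measure_display} {Z : measurableType d}.
Variable k : R.-pker Z ~> Z.
Context {dO : measure_display} {Omega : measurableType dO}.
Variables (P : probability Omega R) (Zp : nat -> Omega -> Z) (mu : probability Z R).
Hypothesis chainP : is_markov_chain P Zp k mu.

Lemma measurable_chain_sum_ge (w : Z -> R) n t : measurable_fun setT w ->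
  measurable [set o | t <= \sum_(i < n) w (Zp i o)].
Proof.
move=> mw; have [mZp _] := chainP.
rewrite -[X in measurable X]setTI.
have mS : measurable_fun setT (fun o => \sum_(i < n) w (Zp i o)).
  by apply: measurable_sum => i; exact: measurableT_comp.
rewrite (_ : [set o | _] = (fun o => \sum_(i < n) w (Zp i o)) @^-1` `[t, +oo[).
  exact: mS.
by apply/seteqP; split => o; rewrite /= in_itv/= andbT.
Qed.

(** Markov's inequality for the exponential moment, with [expR (th * w)] replaced by its simple
    majorant so that [chain_expectation] applies. The remaining [th * K] bounds the final partial
    sum left by [mul_kprod_le]. *)
Lemma chain_sum_tail (w : Z -> R) (K th s t : R) n :
  bounded_measurable w -> (forall m x, `|kpsum k w m x| <= K) ->
  0 <= th -> th * K <= 4^-1 -> 0 < s -> (0 < n)%N ->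
  (P [set o | (t <= \sum_(i < n) w (Zp i o))%R] <=
   (expR (n%:R * (th * s + 8 * (th * K) ^+ 2) + th * K - th * t))%:E)%E.
Proof.
case: n => // n bw hK th0 thK s0 _.
have [N [c [B [mB hg]]]] := simple_expR_majorant _ _ _ _ _ _ bw th0 s0.
pose g z := \sum_(j < N) c j * \1_(B j) z.
have {}hg z : expR (th * w z) <= g z <= expR (th * (w z + s)) := hg z.
have g0 z : 0 <= g z by have /andP[+ _] := hg z; exact: le_trans (expR_ge0 _).
have bg : bounded_measurable g.
  by apply: bounded_measurable_sum => j; exact: bounded_measurable_indic.
have bgZp i : bounded_measurable (g \o Zp i).
  have [mZp _] := chainP; have [mg [M hM]] := bg.
  by split; [exact: measurableT_comp|exists M => o; exact: hM].
have bprod := bounded_measurable_prod n.+1 _ bgZp.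
set F := [set o | _].
have mF : measurable F by apply: measurable_chain_sum_ge; case: bw.
have P1 := probability_setT P.
have PF : P F = (\int[P]_o \1_F o)%:E.
  by rewrite /Rintegral integral_indic// setIT fineK// fin_num_measure.
rewrite PF lee_fin.
apply: (@le_trans _ _ (\int[P]_o (expR (- (th * t)) * \prod_(j < n.+1) g (Zp j o)))).
  apply: le_Rintegral => //.
  - by apply: bounded_measurable_integrable => //; exact: bounded_measurable_indic.
  - by apply: bounded_measurable_integrable => //; exact: bounded_measurableZ.
  move=> o _; rewrite indicE; case: (boolP (o \in F)) => [|_]; last first.
    by rewrite mulr_ge0 ?expR_ge0// prodr_ge0.
  rewrite inE => Fo; apply: (@le_trans _ _
    (expR (- (th * t)) * \prod_(j < n.+1) expR (th * w (Zp j o)))).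
    rewrite -expR_sum -expRD -mulr_sumr -[leLHS]expR0 ler_expR.
    by rewrite addrC subr_ge0 ler_wpM2l.
  rewrite ler_wpM2l ?expR_ge0//; apply: ler_prod => j _.
  by rewrite expR_ge0; case/andP: (hg (Zp j o)).
rewrite RintegralZl//; last exact: bounded_measurable_integrable.
rewrite addrC expRD ler_wpM2l ?expR_ge0//.
rewrite (chain_expectation _ _ _ _ chainP)//.
have bgp : bounded_measurable (fun z => g z * kprod k g n z).
  exact/bounded_measurableM/bounded_measurable_kprod.
have kp0 z : 0 <= kprod k g n z.
  by elim: n z {bprod F mF PF bgp} => //= m ihm z; apply: Rintegral_ge0 => y _; rewrite mulr_ge0.
set C := expR _.
have gkC z : 0 <= g z * kprod k g n z <= C.
  rewrite mulr_ge0//=.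
  apply: le_trans (mul_kprod_le k g w K th s n z bg bw _ hK th0 thK) _.
    by move=> x; rewrite g0; case/andP: (hg x).
  rewrite ler_expR lerD2l ler_wpM2l//.
  exact: le_trans (ler_norm _) (hK _ _).
by have /andP[] := bounded_Rintegral mu _ 0 C (probability_setT mu) (proj1 bgp) gkC.
Qed.

End Concentration.

(** Over the denominator [256 * K ^+ 2] the numerator is [- 6 * (n * eps ^+ 2) + 16 * K * eps]. The
    first threshold bounds the last term by [n * eps ^+ 2], the second gives
    [512 * K ^+ 2 * l <= 4 * (n * eps ^+ 2)]. *)
Lemma azuma_exponent_le (R : realType) (K eps l n : R) :
  0 < eps -> 0 < K -> 0 <= l -> 16 * K / eps <= n ->
  128 * K ^+ 2 * l / eps ^+ 2 <= n ->
  n * (eps / (16 * K ^+ 2) * (eps / 8) + 8 * (eps / (16 * K ^+ 2) * K) ^+ 2)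
    + eps / (16 * K ^+ 2) * K - eps / (16 * K ^+ 2) * (n * eps) <= - (2 * l).
Proof.
move=> e0 K0 l0; rewrite !ler_pdivrMr ?exprn_gt0// => h1 h2.
have -> : n * (eps / (16 * K ^+ 2) * (eps / 8) + 8 * (eps / (16 * K ^+ 2) * K) ^+ 2)
    + eps / (16 * K ^+ 2) * K - eps / (16 * K ^+ 2) * (n * eps) =
   (- 6 * (n * eps ^+ 2) + 16 * K * eps) / (256 * K ^+ 2).
  by field; rewrite gt_eqF.
rewrite ler_pdivrMr ?mulr_gt0 ?exprn_gt0//.
have : 16 * K * eps <= n * eps * eps by rewrite ler_pM2r.
have : 0 <= K ^+ 2 * l by rewrite mulr_ge0// sqr_ge0.
move: h2; rewrite !expr2; nra.
Qed.

(** * Uniform bound on the partial sums of the Poisson series *)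

Section PoissonSumBound.
Context {R : realType} {d : measure_display} {Z : measurableType d}.
Variable k : R.-pker Z ~> Z.

Lemma iter_ktrans_affine (f : Z -> R) a c n : bounded_measurable f ->
  iter n (ktrans k) (fun x => a * (f x - c)) =
  (fun x => a * (iter n (ktrans k) f x - c)).
Proof.
move=> bf; elim: n => //= n ->; apply/funext => z.
have bi := bounded_measurable_iter_ktrans k f n bf.
have bc := bounded_measurable_cst c.
by rewrite ktransZ ?ktransB ?ktrans_cst//; exact: bounded_measurableB.
Qed.

Lemma geometric_sum_le (q : R) m : 0 <= q < 1 -> \sum_(i < m) q ^+ i <= (1 - q)^-1.
Proof.
move=> /andP[q0 q1]; rewrite -[leRHS]mul1r ler_pdivlMr ?subr_gt0// mulrC.
rewrite -opprB mulNr -subrX1 opprB; have := exprn_ge0 m q0; lra.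
Qed.

(** The ergodic estimates of the terms add up to a geometric series. The factor [a] lets one bound
    serve both the upper and the lower tail. *)
Lemma kpsum_ergodic_le (pi : probability Z R) (rho : Z -> Z -> R)
    (L C1 C2 a : R) (f : Z -> R) m z :
  bounded_measurable f -> (forall x, 0 <= f x) -> 0 <= L ->
  (forall x y, `|f x - f y| <= L * rho x y) -> 0 < C1 -> 0 < C2 ->
  (forall z n, (wasserstein rho (kpow k n z) pi <= (C1 * expR (- C2 * n%:R))%:E)%E) ->
  `|a| <= 1 ->
  `|kpsum k (fun x => a * (f x - \int[pi]_y f y)) m z|
     <= C1 * L / (1 - expR (- C2)).
Proof.
move=> bf f0 L0 hf C10 C20 hW a1; rewrite /kpsum.
apply: le_trans (ler_norm_sum _ _ _) _.
apply: (@le_trans _ _ (\sum_(i < m) C1 * L * expR (- C2) ^+ i)).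
  apply: ler_sum => i _; rewrite iter_ktrans_affine// normrM.
  have h := iter_ktrans_ergodic k pi rho L _ f i z bf f0 L0 hf (hW z i).
  apply: le_trans (ler_pM (normr_ge0 _) (normr_ge0 _) a1 h) _.
  by rewrite mul1r expRM_natr mulrA (mulrC L).
rewrite -mulr_sumr ler_wpM2l ?mulr_ge0 ?(ltW C10)//.
by apply: geometric_sum_le; rewrite expR_ge0 expR_lt1 oppr_lt0.
Qed.

End PoissonSumBound.

(** * Covering numbers, the union bound and sample means *)

(** [covering_number] is a real infimum, but of natural numbers, so the least covering size attains
    it. *)
Lemma covering_number_attained (R : realType) (T : Type) (H : set T)
    (rhoH : T -> T -> R) (r : \bar R) :
  (exists n, is_covering H rhoH r n) ->
  exists2 N, is_covering H rhoH r N & covering_number H rhoH r = N%:R.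
Proof.
move=> [n0 cov0]; have ex : exists n, `[< is_covering H rhoH r n >].
  by exists n0; exact/asboolP.
have [N /asboolP covN minN] := ex_minnP ex; exists N => //.
apply/eqP; rewrite eq_le; apply/andP; split.
  by apply: ge_inf; [exists 0 => _ [m _ <-]|exists N].
apply: lb_le_inf; first by exists N%:R, N.
by move=> _ [m cov <-]; rewrite ler_nat; apply: minN; exact/asboolP.
Qed.

Lemma measure_bigsetU_le (R : realType) (d : measure_display)
    (T : measurableType d) (m : {measure set T -> \bar R}) N
    (F : 'I_N -> set T) (b : R) :
  (forall i, measurable (F i)) -> (forall i, (m (F i) <= b%:E)%E) ->
  (m (\big[setU/set0]_(i < N) F i) <= (N%:R * b)%:E)%E.
Proof.
elim: N F => [|N ih] F mF hF; first by rewrite big_ord0 measure0 mul0r.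
rewrite big_ord_recr; apply: le_trans (measureU2 _ _ _) _ => //.
  exact: bigsetU_measurable.
rewrite -natr1 mulrDl mul1r EFinD; apply: leeD; last exact: hF.
exact: (ih (fun i => F (widen_ord (leqnSn N) i))).
Qed.

Lemma mean_norm_le (R : realType) (T : Type) (s : seq T) (u : T -> R) (e : R) :
  0 <= e -> (forall x, `|u x| <= e) ->
  `|(size s)%:R^-1 * \sum_(x <- s) u x| <= e.
Proof.
move=> e0 hu; case: s => [|x s]; first by rewrite big_nil mulr0 normr0.
rewrite normrM ger0_norm ?invr_ge0// mulrC ler_pdivrMr ?ltr0n//.
apply: le_trans (ler_norm_sum _ _ _) _.
have -> : e * (size (x :: s))%:R = \sum_(y <- x :: s) e.
  by rewrite mulr_natr big_const_seq count_predT iter_addr_0.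
by apply: ler_sum.
Qed.

(** * From uniform deviation to the error of the algorithm *)

Section Learning.
Context {R : realType} {dX : measure_display} {X : measurableType dX}
  {d : measure_display} {Z : measurableType d}.
Variables (lh : (X -> R) -> Z -> R) (H : set (X -> R)) (pi : probability Z R).

Lemma emp_errB h (c : R) (s : seq Z) : (0 < size s)%N ->
  emp_err lh h s - c = (size s)%:R^-1 * \sum_(z <- s) (lh h z - c).
Proof.
move=> s0; rewrite sumrB mulrBr; congr (_ - _).
rewrite big_const_seq count_predT iter_addr_0 -[c *+ _]mulr_natl mulKf//.
by rewrite pnatr_eq0 -lt0n.
Qed.

Lemma emp_err_dist h h' (e : R) (s : seq Z) : 0 <= e ->
  (forall z, `|lh h z - lh h' z| <= e) ->
  `|emp_err lh h s - emp_err lh h' s| <= e.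
Proof.
by move=> e0 hh; rewrite /emp_err -mulrBr -sumrB; exact: mean_norm_le.
Qed.

Lemma er_pi_dist h h' (e : R) :
  bounded_measurable (lh h) -> bounded_measurable (lh h') ->
  (forall z, `|lh h z - lh h' z| <= e) ->
  `|er_pi pi lh h - er_pi pi lh h'| <= e.
Proof.
move=> bh bh' hh; rewrite /er_pi -RintegralB//; last 2 first.
- exact: bounded_measurable_integrable (probability_setT pi) bh.
- exact: bounded_measurable_integrable (probability_setT pi) bh'.
apply: norm_Rintegral_le hh; first exact: probability_setT.
by case: (bounded_measurableB _ _ bh bh').
Qed.

Hypothesis lh0 : forall h z, H h -> 0 <= lh h z.

Let er_lb : has_lbound [set er_pi pi lh h | h in H].
Proof. by exists 0 => _ [h Hh <-]; apply: Rintegral_ge0 => z _; exact: lh0. Qed.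

Lemma opt_pi_dist h0 (e : R) : H h0 ->
  (forall h, H h -> er_pi pi lh h0 - e <= er_pi pi lh h) ->
  `|er_pi pi lh h0 - opt_pi pi lh H| <= e.
Proof.
move=> Hh0 hh.
have h1 : opt_pi pi lh H <= er_pi pi lh h0 by apply: ge_inf => //; exists h0.
rewrite ger0_norm ?subr_ge0// lerBlDr -lerBlDl.
by apply: lb_le_inf; [exists (er_pi pi lh h0), h0|move=> _ [h Hh <-]; exact: hh].
Qed.

(** Passing from true to empirical error and back costs [3 / 2 * eps] each time and approximate
    minimisation costs [eps], [4 * eps] in all. *)
Lemma ASEM_error_lt (A : seq Z -> X -> R) (eps : R) (s : seq Z) :
  is_ASEM lh H eps A -> (0 < size s)%N ->
  (forall h, H h -> `|emp_err lh h s - er_pi pi lh h| <= (3 / 2) * eps) -> 0 < eps ->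
  `|er_pi pi lh (A s) - opt_pi pi lh H| < 5 * eps.
Proof.
move=> asem s0 dev e0; have [HA Aemp] := asem s s0.
apply: (@le_lt_trans _ _ (4 * eps)); last by lra.
apply: opt_pi_dist => // h Hh.
have : inf [set emp_err lh h s | h in H] <= emp_err lh h s.
  apply: ge_inf; last by exists h.
  exists 0 => _ [h' Hh' <-]; rewrite mulr_ge0 ?invr_ge0//.
  by apply: sumr_ge0 => z _; exact: lh0.
by have := dev _ HA; have := dev _ Hh; rewrite !ler_norml; lra.
Qed.

End Learning.

(** * Assembly: degenerate cases, then a union bound over a minimal covering *)

Theorem theorem1p1
  (R : realType)
  (dX : measure_display) (X : measurableType dX)
  (d : measure_display) (Z : measurableType d)
  (rho : Z -> Z -> R)
  (prX : Z -> X) (prY : Z -> R) (Ys : set R)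
  (k : R.-pker Z ~> Z)
  (H : set (X -> R)) (rhoH : (X -> R) -> (X -> R) -> R)
  (ell : R -> R -> R) (L Lbar eta : R)
  (pi : probability Z R) (C1 C2 eps delta : R)
  (A : seq Z -> (X -> R))
  (dO : measure_display) (Omega : measurableType dO) (P : probability Omega R)
  (Zp : nat -> Omega -> Z) (mu : probability Z R) :
  (* Z : complete separable metric space, bounded metric, Borel σ-algebra *)
  is_metric rho -> metric_bounded rho -> metric_complete rho ->
  metric_separable rho -> is_borel_of rho ->
  (* Z ⊆ X × Y via z ↦ (pr_X z, pr_Y z), projections measurable *)
  injective (fun z => (prX z, prY z)) -> (forall z, Ys (prY z)) ->
  measurable_fun setT prX -> measurable_fun setT prY ->
  (* (A1) *)
  (forall h, H h -> forall x, Ys (h x)) ->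
  is_metric_on H rhoH -> totally_bounded_on H rhoH ->
  (* (A2) *)
  (forall y1 y2, Ys y1 -> Ys y2 -> 0 <= ell y1 y2) ->
  trace_measurable (Ys `*` Ys) (fun p : R * R => ell p.1 p.2) ->
  0 <= L -> 0 <= Lbar ->
  (forall z1 z2 h1 h2, H h1 -> H h2 ->
     `|loss_h ell prX prY h1 z1 - loss_h ell prX prY h2 z2|
       <= L * rho z1 z2 + Lbar * rhoH h1 h2) ->
  (* (A3) *)
  (exists M : R, forall y, Ys y -> `|y| <= M) ->
  0 < eta < 1 ->
  (forall z1 z2, (wasserstein rho (k z1) (k z2) <= ((1 - eta) * rho z1 z2)%:E)%E) ->
  (* invariant measure and geometric ergodicity constants *)
  invariant_measure k pi ->
  0 < C1 -> 0 < C2 ->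
  (forall z n, (wasserstein rho (kpow k n z) pi <= (C1 * expR (- C2 * n%:R))%:E)%E) ->
  (* ε, δ, ε-ASEM algorithm *)
  0 < eps -> 0 < delta < 1 ->
  is_ASEM (loss_h ell prX prY) H eps A ->
  (* the chain under P_μ *)
  is_markov_chain P Zp k mu ->
  forall n : nat, (0 < n)%N ->
    n1 C1 C2 L Lbar eps delta H rhoH <= n%:R ->
    exists E : set Omega, [/\ measurable E,
      E `<=` [set w | `| er_pi pi (loss_h ell prX prY)
                            (A [seq Zp i w | i <- iota 0 n])
                         - opt_pi pi (loss_h ell prX prY) H | < 5 * eps] &
      ((1 - delta)%:E <= P E)%E].
Proof.
move=> rho_m [M rhoM] _ _ borel _ YsZ _ _ HYs rhoH_m tb ell0 _ L0 Lbar0 lipell _ _ _ _.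
move=> C10 C20 hW eps0 /andP[delta0 delta1] asem chainP n n0.
set lh := loss_h ell prX prY; pose q := expR (- C2).
pose r : \bar R := if Lbar == 0 then +oo%E else (eps / (4 * Lbar))%:E.
rewrite /n1 ge_max -/q -/r => /andP[n_ge1 n_ge2].
have [_ rho_eq0 _ _] := rho_m; have [_ rhoH_eq0 _ _] := rhoH_m.
have lh0 h z : H h -> 0 <= lh h z by move=> Hh; apply: ell0 => //; exact: HYs.
have lipz h : H h -> forall x y, `|lh h x - lh h y| <= L * rho x y.
  move=> Hh x y; have := lipell x y h h Hh Hh.
  by rewrite ((rhoH_eq0 h h Hh Hh).2 erefl) mulr0 addr0.
have liph h h' z : H h -> H h' -> `|lh h z - lh h' z| <= Lbar * rhoH h h'.
  move=> Hh Hh'; have := lipell z z h h' Hh Hh'.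
  by rewrite ((rho_eq0 z z).2 erefl) mulr0 add0r.
have blh h : H h -> bounded_measurable (lh h).
  move=> Hh; split; first exact: lipschitz_measurable borel L0 (lipz h Hh).
  exists (`|lh h point| + L * M) => z.
  rewrite -[lh h z](subrK (lh h point)) addrC (le_trans (ler_normD _ _))// lerD2l.
  by apply: le_trans (lipz h Hh _ _) _; rewrite ler_wpM2l.
have q1 : 0 < 1 - q by rewrite subr_gt0 expR_lt1 oppr_lt0.
pose K := C1 * L / (1 - q).
have psumK h a m z : H h -> `|a| <= 1 ->
    `|kpsum k (fun x => a * (lh h x - er_pi pi lh h)) m z| <= K.
  move=> Hh a1; apply: (kpsum_ergodic_le _ _ rho) => //; [exact: blh| |exact: lipz].
  by move=> x; exact: lh0.
pose Zs o := [seq Zp i o | i <- iota 0 n].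
have size_Zs o : size (Zs o) = n by rewrite size_map size_iota.
have sum_Zs o (u : Z -> R) : \sum_(z <- Zs o) u z = \sum_(i < n) u (Zp i o).
  by rewrite big_map -(big_mkord xpredT (fun i => u (Zp i o))) /index_iota subn0.
have HA o : H (A (Zs o)) by have [] := asem (Zs o); rewrite ?size_Zs.
have PT : ((1 - delta)%:E <= P setT)%E.
  by rewrite [X in (_ <= X)%E]probability_setT lee_fin; lra.
(* The complementary case [eps < K] provides [K > 0] and the smallness of [th * K] needed for the
   tail bound. *)
have [K_le|K_gt] := leP K eps.
  exists setT; split => // o _ /=; apply: (ASEM_error_lt _ H) => //.
    by rewrite -/(Zs o) size_Zs.
  move=> h Hh; rewrite -/(Zs o) emp_errB ?size_Zs//.
  rewrite -{1}(size_Zs o); apply: le_trans (mean_norm_le _ _ _ _ K _ _) _; last by lra.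
  - by apply: le_trans (psumK h 0 0%N point Hh _); rewrite ?normr0.
  (* The partial sum with a single term is the centred loss itself, so [K] bounds it pointwise. *)
  - move=> z; have := psumK h 1 1%N z Hh; rewrite normr1 => /(_ (lexx _)).
    by rewrite /kpsum big_ord_recl big_ord0 addr0 /= mul1r.
have [N [f [Hf cov]] NE] : exists2 N, is_covering H rhoH r N &
    covering_number H rhoH r = N%:R.
  apply: covering_number_attained; rewrite /r; case: eqVneq => [_|Lbar_neq0].
    (* At radius [+oo] any finite covering will do, such as one of radius [1]. *)
    have [m [f [Hf cov]]] := tb 1 ltr01.
    by exists m, f; split => // h /cov[i _]; exists i; rewrite ltry.
  by apply: tb; rewrite divr_gt0// mulr_gt0// lt_neqAle eq_sym Lbar_neq0.
have near h : H h -> exists i, forall z, `|lh h z - lh (f i) z| <= eps / 4.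
  move=> Hh; have [i hi] := cov h Hh; exists i => z.
  apply: le_trans (liph _ _ z Hh (Hf i)) _.
  move: hi; rewrite /r; case: eqVneq => [-> _|Lbar_neq0].
    by rewrite mul0r divr_ge0// ltW.
  have Lbar_gt0 : 0 < Lbar by rewrite lt_neqAle eq_sym Lbar_neq0.
  rewrite lte_fin ltr_pdivlMr ?mulr_gt0// => hi.
  by rewrite mulrCA mulrA -mulrA in hi; lra.
rewrite NE in n_ge2.
have [N1|N2] := leqP N 1.
  exists setT; split => // o _ /=; rewrite -/(Zs o).
  apply: (@le_lt_trans _ _ (eps / 2)); last by lra.
  apply: (opt_pi_dist _ H) => // h Hh.
  have [i hi] := near _ (HA o); have [j hj] := near _ Hh.
  (* With at most one centre, both hypotheses are within [eps / 4] of the same [f i]. *)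
  have ij : i = j.
    apply: val_inj => /=; move: (leq_trans (ltn_ord i) N1) (leq_trans (ltn_ord j) N1).
    by rewrite !ltnS !leqn0 => /eqP-> /eqP->.
  subst j.
  have := er_pi_dist lh pi _ _ _ (blh _ (HA o)) (blh _ (Hf i)) hi.
  have := er_pi_dist lh pi _ _ _ (blh _ Hh) (blh _ (Hf i)) hj.
  by rewrite !ler_norml; lra.
have K0 : 0 < K by exact: lt_trans K_gt.
have Nd0 : 0 < N%:R / delta by rewrite divr_gt0// ltr0n ltnW.
pose l := ln (N%:R / delta).
have l0 : 0 <= l.
  apply: ln_ge0; rewrite ler_pdivlMr// mul1r (le_trans (ltW delta1))//.
  by rewrite ler1n ltnW.
(* This is [expR (- (2 * l))]. Of its two factors [delta / N%:R], one pays for the [N] centres and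
   the other, at most [1 / 2], for the two tails. *)
pose b := (delta / N%:R) ^+ 2.
pose Bad i a := [set o |
  n%:R * eps <= \sum_(j < n) a * (lh (f i) (Zp j o) - er_pi pi lh (f i))].
have bw i a : bounded_measurable (fun x => a * (lh (f i) x - er_pi pi lh (f i))).
  apply/bounded_measurableZ/bounded_measurableB; first exact: blh.
  exact: bounded_measurable_cst.
have mBad i a : measurable (Bad i a).
  exact: (measurable_chain_sum_ge _ _ _ _ chainP) (proj1 (bw i a)).
have PBad i a : `|a| <= 1 -> (P (Bad i a) <= b%:E)%E.
  (* The minimiser of [8 * (th * K) ^+ 2 - th * eps]. *)
  move=> a1; pose th := eps / (16 * K ^+ 2).
  have th0 : 0 <= th by rewrite ltW// divr_gt0// mulr_gt0// exprn_gt0.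
  have thK : th * K <= 4^-1.
    have -> : th * K = eps / (16 * K) by rewrite /th; field; rewrite gt_eqF.
    by rewrite ler_pdivrMr ?(mulr_gt0 _ K0)//; lra.
  apply: le_trans (chain_sum_tail k P Zp mu chainP _ K th (eps / 8) (n%:R * eps)
    n (bw i a) _ th0 thK _ n0) _.
  - by move=> m x; exact: psumK.
  - by rewrite divr_gt0.
  rewrite lee_fin; apply: (@le_trans _ _ (expR (- (2 * l)))).
    rewrite ler_expR; apply: azuma_exponent_le => //.
    (* Once [K] is unfolded, the two terms of [n1] are exactly [16 * K / eps] and
       [128 * K ^+ 2 * l / eps ^+ 2]. *)
    - apply: le_trans n_ge1; rewrite /K le_eqVlt; apply/orP; left; apply/eqP; field.
      by rewrite !gt_eqF.
    - apply: le_trans n_ge2; rewrite /K -/l le_eqVlt; apply/orP; left; apply/eqP; field.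
      by rewrite !gt_eqF.
  by rewrite expRN expRM_natl lnK// -exprVn invf_div.
pose U := \big[setU/set0]_(i < N) (Bad i 1 `|` Bad i (-1)).
have mU : measurable U by apply: bigsetU_measurable => i _; exact: measurableU.
have PU : (P U <= delta%:E)%E.
  apply: (@le_trans _ _ (N%:R * (2 * b))%:E).
    apply: measure_bigsetU_le => i; first exact: measurableU.
    apply: le_trans (measureU2 _ _ _) _ => //.
    by rewrite mulr_natl mulr2n EFinD; apply: leeD; apply: PBad; rewrite ?normrN normr1.
  rewrite lee_fin /b.
  have N0 : 0 < N%:R :> R by rewrite ltr0n ltnW.
  have -> : N%:R * (2 * (delta / N%:R) ^+ 2) = delta * (2 * delta / N%:R).
    by field; rewrite gt_eqF.
  rewrite ler_piMr ?(ltW delta0)// ler_pdivrMr// mul1r.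
  have : 2 <= N%:R :> R by rewrite ler_nat.
  lra.
(* [A] is an arbitrary map, so the success event may fail to be measurable; the complement of [U] is
   a measurable event inside it. *)
exists (~` U); split; first exact: measurableC.
  move=> o Uo /=; rewrite -/(Zs o).
  have good i : `|emp_err lh (f i) (Zs o) - er_pi pi lh (f i)| <= eps.
    rewrite leNgt; apply/negP => gt_eps; apply: Uo.
    rewrite /U (bigD1 i)//=; left.
    move: gt_eps; rewrite emp_errB ?size_Zs// sum_Zs.
    have nR : 0 < n%:R :> R by rewrite ltr0n.
    rewrite normrM ger0_norm ?invr_ge0// mulrC ltr_pdivlMr// mulrC lter_normr.
    case/orP => [h|h]; [left|right]; rewrite /Bad /= -mulr_sumr ?mul1r ?mulN1r; exact: ltW.
  (* The deviation [3 / 2 * eps] is [eps] at the centre plus [eps / 4] for each of the empirical and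
     true errors. *)
  apply: (ASEM_error_lt _ H) => //; first by rewrite size_Zs.
  move=> h Hh; have [i hi] := near _ Hh.
  have := er_pi_dist lh pi _ _ _ (blh _ Hh) (blh _ (Hf i)) hi.
  have e4 : 0 <= eps / 4 by rewrite divr_ge0// ltW.
  have := emp_err_dist lh h (f i) (eps / 4) (Zs o) e4 hi.
  by have := good i; rewrite !ler_norml; lra.
rewrite probability_setC// -(@fineK _ (P U)) ?fin_num_measure// -EFinB lee_fin.
by rewrite lerD2l lerN2 -lee_fin fineK// fin_num_measure.
Qed.
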